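(* Let $Q\le G$ be groups, $M$ a $\mathbb ZQ$-module, and $T$ a right transversal to $Q$ in $G$ containing $1_G$. For $\mu\in C^n(Q,M)$, $\mathbf g_1,\dots,\mathbf g_n\in G$ and $\mathbf t\in T$ define $$\psi(\mu)(\mathbf g_1,\dots,\mathbf g_n)(\mathbf t)=\mu(\mathbf h_1,\dots,\mathbf h_n),$$ where $\mathbf h_k\in Q$ and $\mathbf s_k\in T$ are uniquely determined by $\mathbf s_0=\mathbf t$ and $\mathbf s_{k-1}\mathbf g_k=\mathbf h_k\mathbf s_k$ for $k=1,\dots,n$. For $\theta\in C^n(G,\mathrm{Coind}_Q^G(M))$ and $\mathbf h_1,\dots,\mathbf h_n\in Q$ define $$\phi(\theta)(\mathbf h_1,\dots,\mathbf h_n)=\theta(\mathbf h_1,\dots,\mathbf h_n)(1_G).$$ Then $\psi:C^*(Q,M)\to C^*(G,\mathrm{Coind}_Q^G(M))$ and $\phi:C^*(G,\mathrm{Coind}_Q^G(M))\to C^*(Q,M)$ are isomorphisms of cochain complexes in the homotopy category (i.e. they are homotopy equivalences).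
   Context: $C^n(G,N)$ denotes the group of all functions $G^n\to N$ with the standard (inhomogeneous) differential $(d\theta)(\mathbf g_1,\dots,\mathbf g_{n+1})=\mathbf g_1\theta(\mathbf g_2,\dots,\mathbf g_{n+1})+\sum_{k=1}^n(-1)^k\theta(\dots,\mathbf g_k\mathbf g_{k+1},\dots)+(-1)^{n+1}\theta(\mathbf g_1,\dots,\mathbf g_n)$. The coinduced module $\mathrm{Coind}_Q^G(M)$ is the group of $Q$-equivariant functions $f:G\to M$, $f(\mathbf q\mathbf x)=\mathbf q f(\mathbf x)$ for $\mathbf q\in Q$, with $G$-action $(\mathbf gf)(\mathbf x)=f(\mathbf x\mathbf g)$. Since such a function is determined by its (arbitrary) values on $T$, $\mathrm{Coind}_Q^G(M)$ is identified with the set of functions $T\to M$. A right transversal means $G=\bigsqcup_{\mathbf t\in T}Q\mathbf t$. *)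

(* Defs.v *)
From HB Require Import structures.
From mathcomp Require Import all_boot ssralg ssrint zify.
From mathcomp Require Import boolp classical_sets functions.

Set Implicit Arguments.
Unset Strict Implicit.
Unset Printing Implicit Defensive.

Import GRing.Theory.
Local Open Scope ring_scope.

(* Modules over the integral group ring of G, presented as abelian groups with
   an additive action of G. *)
HB.mixin Record isGModule (G : groupType) M of GRing.Zmodule M := {
  gact : G -> M -> M;
  gact_is_additive : forall g, {morph gact g : x y / x + y};
  gact1 : forall x, gact 1%g x = x;
  gactM : forall g h x, gact (g * h)%g x = gact g (gact h x)
}.

#[short(type="gmodType")]
HB.structure Definition GModule (G : groupType) :=
  {M of isGModule G M & GRing.Zmodule M}.

Section GModuleTheory.
Variables (G : groupType) (M : gmodType G).
Implicit Types (g : G) (x y : M).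

Lemma gactD g : {morph @gact G M g : x y / x + y}.
Proof. exact: gact_is_additive. Qed.

Lemma gact0 g : gact g (0 : M) = 0.
Proof. by apply: (addrI (gact g (0 : M))); rewrite -gactD !addr0. Qed.

Lemma gactN g : {morph @gact G M g : x / - x}.
Proof. by move=> x; apply: (addrI (gact g x)); rewrite -gactD !subrr gact0. Qed.

Lemma gactB g : {morph @gact G M g : x y / x - y}.
Proof. by move=> x y; rewrite gactD gactN. Qed.

HB.instance Definition _ g :=
  GRing.isZmodMorphism.Build M M (@gact G M g) (gactB g).

End GModuleTheory.

Record cochain_complex := CochainComplex {
  cc_obj :> nat -> zmodType;
  cc_diff : forall n, {additive cc_obj n -> cc_obj n.+1};
  cc_diffK : forall n (x : cc_obj n), cc_diff n.+1 (cc_diff n x) = 0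
}.

Section HomotopyCategory.
Implicit Types C D : cochain_complex.

Definition is_cochain_map C D (f : forall n, C n -> D n) : Prop :=
  (forall n, zmod_morphism (f n)) /\
  (forall n x, f n.+1 (cc_diff C n x) = cc_diff D n (f n x)).

Definition cochain_homotopic C D (f g : forall n, C n -> D n) : Prop :=
  exists s : forall n, {additive C n.+1 -> D n},
    (forall x, f 0%N x - g 0%N x = s 0%N (cc_diff C 0%N x)) /\
    (forall n x, f n.+1 x - g n.+1 x =
                 cc_diff D n (s n x) + s n.+1 (cc_diff C n.+1 x)).

Definition homotopy_equivalence C D (f : forall n, C n -> D n) : Prop :=
  is_cochain_map f /\
  exists g : forall n, D n -> C n,
    [/\ is_cochain_map g,
        cochain_homotopic (fun n => g n \o f n) (fun n => @idfun (C n)) &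
        cochain_homotopic (fun n => f n \o g n) (fun n => @idfun (D n))].

End HomotopyCategory.

Lemma alternating_sum0 (V : zmodType) (N : nat) (A : nat -> nat -> V) :
  (forall i j, (i < j <= N)%N -> A j i = - A i j.-1) ->
  \sum_(j < N.+1) \sum_(i < N) A j i = 0.
Proof.
elim: N => [|N IHN] hA; first by rewrite big1 // => j _; rewrite big_ord0.
rewrite big_ord_recr /=.
under eq_bigr do rewrite big_ord_recr /=.
rewrite big_split /= IHN ?add0r; last first.
  by move=> i j /andP[ij jN]; apply: hA; rewrite ij leqW.
rewrite -big_split /= big1 // => i _.
by rewrite [A N.+1 i]hA ?subrr //= ltn_ord leqnn.
Qed.

Section InhomogeneousCochains.
Variables (G : groupType) (N : gmodType G).

Definition cochains (n : nat) : zmodType := (n.-tuple G -> N : zmodType).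

(* (g_1, .., g_k g_{k+1}, .., g_{n+1}), for 1 <= k <= n *)
Definition merge_face n (k : nat) (g : n.+1.-tuple G) : n.-tuple G :=
  [tuple if (i.+1 < k)%N then nth 1%g g i
         else if (i.+1 == k)%N then (nth 1 g i * nth 1 g i.+1)%g
         else nth 1%g g i.+1 | i < n].

Definition last_face n (g : n.+1.-tuple G) : n.-tuple G :=
  [tuple tnth g (widen_ord (leqnSn n) i) | i < n].

Definition cochain_diff n (theta : cochains n) : cochains n.+1 := fun g =>
  gact (thead g) (theta (behead_tuple g))
  + \sum_(1 <= k < n.+1) theta (merge_face k g) *~ (-1) ^+ k
  + theta (last_face g) *~ (-1) ^+ n.+1.

Lemma cochain_diff_is_additive n : zmod_morphism (@cochain_diff n).
Proof.
move=> a b; apply/funext => g.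
have E m (f h : cochains m) x : (f - h) x = f x - h x by [].
rewrite E /cochain_diff !E gactB mulrzBl.
under eq_bigr do rewrite E mulrzBl.
rewrite sumrB; set u := (X in X - _ + _ + _); set u' := (X in _ - X + _ + _).
by rewrite (addrACA u) -opprD addrACA -opprD.
Qed.

HB.instance Definition _ n :=
  GRing.isZmodMorphism.Build (cochains n) (cochains n.+1) (@cochain_diff n)
    (@cochain_diff_is_additive n).

Let tw (k : nat) n (g : n.-tuple G) (x : N) : N :=
  if k == 0%N then gact (nth 1%g g 0) x else x.

Let cochain_diffE n (theta : cochains n) g :
  cochain_diff theta g =
  \sum_(k < n.+2) tw k g (theta (merge_face k g)) *~ (-1) ^+ k.
Proof.
rewrite big_ord_recr big_ord_recl /= expr0 mulr1z; congr (_ + _ + _).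
- rewrite /tw /= [thead g](tnth_nth 1%g) /=; congr (gact _ (theta _)).
  apply: eq_from_tnth => i; rewrite tnth_mktuple /= (tnth_nth 1%g) /=.
  by rewrite nth_behead.
- by rewrite big_add1 /= big_mkord; apply: eq_bigr.
- rewrite /tw /=; congr (theta _ *~ _).
  apply: eq_from_tnth => i; rewrite !tnth_mktuple ltnS ltn_ord.
  by rewrite (tnth_nth 1%g).
Qed.

Let nth_merge n k (g : n.+1.-tuple G) i : (i < n)%N ->
  nth 1%g (merge_face k g) i =
  if (i.+1 < k)%N then nth 1%g g i
  else if (i.+1 == k)%N then (nth 1 g i * nth 1 g i.+1)%g
  else nth 1%g g i.+1.
Proof.
by move=> ltin; rewrite -[i]/(val (Ordinal ltin)) -tnth_nth tnth_mktuple.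
Qed.

Let merge_merge n i j (g : n.+2.-tuple G) : (i < j)%N ->
  merge_face i (merge_face j g) = merge_face j.-1 (merge_face i g).
Proof.
case: j => // j; rewrite ltnS /= => leij.
apply: eq_from_tnth => k; rewrite !tnth_mktuple.
have kn := ltn_ord k; rewrite !nth_merge ?ltnS // ?(ltnW kn) //.
repeat case: ifP => ?; rewrite ?mulgA //; try (exfalso; lia).
Qed.

Let twB k n (g : n.-tuple G) : zmod_morphism (tw k g).
Proof. by rewrite /tw; case: (k == 0%N) => // x y; rewrite gactB. Qed.

Let tw_tw n i j (g : n.+2.-tuple G) x : (i < j)%N ->
  tw j g (tw i (merge_face j g) x) = tw i g (tw j.-1 (merge_face i g) x).
Proof.
case: i j => [|i] [|[|j]] // _; rewrite /tw !nth_merge //=.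
by rewrite gactM.
Qed.

Lemma cochain_diffK n (theta : cochains n) :
  cochain_diff (cochain_diff theta) = 0.
Proof.
apply/funext => g; rewrite cochain_diffE.
pose A j i := tw j g (tw i (merge_face j g)
  (theta (merge_face i (merge_face j g)))) *~ ((-1) ^+ i * (-1) ^+ j).
rewrite -[RHS](@alternating_sum0 _ n.+2 A); last first.
  move=> i j /andP[ltij _]; rewrite /A merge_merge // tw_tw //.
  by case: j ltij => //= j _; rewrite exprS mulN1r mulrN mulrNz mulrC.
apply: eq_bigr => j _; rewrite cochain_diffE.
pose f : {additive N -> N} :=
  HB.pack (tw j g) (GRing.isZmodMorphism.Build N N _ (twB j g)).
rewrite -[tw j g]/(f : N -> N) raddf_sum mulrz_suml.
by apply: eq_bigr => i _; rewrite raddfMz -mulrzA.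
Qed.

Definition cochain_cplx : cochain_complex :=
  @CochainComplex cochains (fun n => @cochain_diff n) cochain_diffK.

End InhomogeneousCochains.

Section CoinducedModule.
Variables (G : groupType) (P : pred G) (Q : subGroupType P) (M : gmodType Q).

Definition equivariant : {pred G -> M} :=
  fun f => `[< forall (q : Q) (x : G), f (val q * x)%g = gact q (f x) >].

Lemma equivariant_zmod_closed : zmod_closed equivariant.
Proof.
split; first by apply/asboolP => q x; rewrite -[0 x]/(0 : M) raddf0.
by move=> f h /asboolP Ef /asboolP Eh; apply/asboolP => q x;
   rewrite !fctE Ef Eh raddfB.
Qed.

Record coind := Coind { coind_fun :> G -> M; _ : coind_fun \in equivariant }.

HB.instance Definition _ := [isSub for coind_fun].
HB.instance Definition _ := [Choice of coind by <:].
HB.instance Definition _ :=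
  GRing.SubChoice_isSubZmodule.Build _ _ coind equivariant_zmod_closed.

Lemma coindE (f : coind) (q : Q) (x : G) : f (val q * x)%g = gact q (f x).
Proof. by have /asboolP := valP f; apply. Qed.

Lemma coind_ext (f h : coind) : f =1 h -> f = h.
Proof. by move=> E; apply/val_inj/funext. Qed.

Lemma coindD (f h : coind) (x : G) : (f + h) x = f x + h x.
Proof. by []. Qed.

Lemma translate_subproof (g : G) (f : coind) :
  (fun x => f (x * g)%g) \in equivariant.
Proof. by apply/asboolP => q x; rewrite -mulgA coindE. Qed.

Definition translate (g : G) (f : coind) : coind :=
  Coind (translate_subproof g f).

Lemma translateD g : {morph translate g : f h / f + h}.
Proof. by move=> f h; apply: coind_ext => x; rewrite coindD. Qed.

Lemma translate1 f : translate 1%g f = f.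
Proof. by apply: coind_ext => x; rewrite /= mulg1. Qed.

Lemma translateM g h f : translate (g * h)%g f = translate g (translate h f).
Proof. by apply: coind_ext => x; rewrite /= mulgA. Qed.

HB.instance Definition _ :=
  isGModule.Build G coind translateD translate1 translateM.

End CoinducedModule.

Section Transversal.
Variables (G : groupType) (P : pred G) (Q : subGroupType P) (T : {pred G}).

(* G is the disjoint union of the cosets Q t, for t in T *)
Definition right_transversal : Prop :=
  forall x : G, exists! t : G, t \in T /\ exists q : Q, x = (val q * t)%g.

Hypothesis trT : right_transversal.

Lemma transversal_decomposition (x : G) :
  exists p : Q * {t : G | t \in T}, (val p.1 * val p.2)%g == x.
Proof.
have [t [[Tt [q ->]] _]] := trT x.
by exists (q, exist _ t Tt).
Qed.

Definition subgroup_part (x : G) : Q := (xchoose (transversal_decomposition x)).1.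

Definition transversal_part (x : G) : {t : G | t \in T} :=
  (xchoose (transversal_decomposition x)).2.

Lemma transversal_partP (x : G) :
  x = (val (subgroup_part x) * val (transversal_part x))%g.
Proof. by have /eqP := xchooseP (transversal_decomposition x). Qed.

Lemma transversal_part_uniq (q : Q) (t : {t : G | t \in T}) :
  (subgroup_part (val q * val t) = q) * (transversal_part (val q * val t) = t).
Proof.
set x := (val q * val t)%g.
have Ex := transversal_partP x.
have [t0 [_ t0_uniq]] := trT x.
have Et : transversal_part x = t.
  apply: val_inj; rewrite -(t0_uniq (val t)); last by split; [exact: valP | exists q].
  by rewrite -(t0_uniq (val (transversal_part x))) //; split;
    [exact: valP | exists (subgroup_part x)].
split=> //; apply: val_inj; apply: (mulIg (val t)).
by rewrite -[in LHS]Et -Ex.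
Qed.

(* coset_walk t g k is s_k, where s_0 = t and s_(k-1) g_k = h_k s_k; the entries
   of g are numbered from 0, so nth 1 g k' is g_k for k = k' + 1. *)
Fixpoint coset_walk (t : {t : G | t \in T}) (g : seq G) (k : nat) :
    {t : G | t \in T} :=
  if k is k'.+1 then transversal_part (val (coset_walk t g k') * nth 1 g k')%g
  else t.

Definition coset_steps n (t : {t : G | t \in T}) (g : n.-tuple G) :
    n.-tuple Q :=
  [tuple subgroup_part (val (coset_walk t g k) * tnth g k)%g | k < n].

Lemma coset_stepsP n t (g : n.-tuple G) (k : 'I_n) :
  (val (coset_walk t g k) * tnth g k =
   val (tnth (coset_steps t g) k) * val (coset_walk t g k.+1))%g.
Proof. by rewrite tnth_mktuple /= -(tnth_nth 1%g); apply: transversal_partP. Qed.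

Variable M : gmodType Q.

Lemma coind_extend_subproof (f : {t : G | t \in T} -> M) :
  (fun x => gact (subgroup_part x) (f (transversal_part x)))
    \in @equivariant G P Q M.
Proof.
apply/asboolP => q x.
have -> : (val q * x = val (q * subgroup_part x) * val (transversal_part x))%g.
  by rewrite [in LHS](transversal_partP x) mulgA valM.
by rewrite !transversal_part_uniq gactM.
Qed.

Definition coind_extend (f : {t : G | t \in T} -> M) : coind M :=
  Coind (coind_extend_subproof f).

Definition coind_restrict (f : coind M) (t : {t : G | t \in T}) : M := f (val t).

Lemma coind_extendK : cancel coind_extend coind_restrict.
Proof.
move=> f; apply/funext => t; rewrite /coind_restrict /=.
have -> : val t = (val (1 : Q) * val t)%g by rewrite val1 mul1g.
by rewrite !transversal_part_uniq gact1.
Qed.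

Lemma coind_restrictK : cancel coind_restrict coind_extend.
Proof.
move=> f; apply: coind_ext => x.
by rewrite /= /coind_restrict -coindE -transversal_partP.
Qed.

Definition shapiro_psi n (mu : cochains M n) : cochains (coind M) n :=
  fun g => coind_extend (fun t => mu (coset_steps t g)).

Definition shapiro_phi n (theta : cochains (coind M) n) : cochains M n :=
  fun h => theta (map_tuple val h) 1%g.

End Transversal.

(* Main.v *)
(* In homogeneous coordinates (x_0, .., x_n) = (y, y g_1, .., y g_1 ... g_n), a
   cochain of G with values in Coind M is a Q-equivariant function on G^(n+1)
   with the simplicial differential, phi is restriction to Q^(n+1), and psi is
   precomposition with the Q-equivariant retraction r : G -> Q sending q t to q.
   Hence phi psi = id, and the prism operator gives a homotopy from psi phi to
   the identity. *)
From HB Require Import structures.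
Require Import Defs.
From mathcomp Require Import all_boot ssralg ssrint zify boolp.

Set Implicit Arguments.
Unset Strict Implicit.
Unset Printing Implicit Defensive.

Import GRing.Theory.
Local Open Scope ring_scope.

(** * Homogeneous coordinates for inhomogeneous cochains *)

Section HomogeneousForm.
Variables (G : groupType) (N : gmodType G).
Implicit Types (x : nat -> G) (y : G).

Definition steps n x : n.-tuple G := [tuple ((x i)^-1 * x i.+1)%g | i < n].

Fixpoint path_of y (g : seq G) (k : nat) : G :=
  if k is k'.+1 then (path_of y g k' * nth 1 g k')%g else y.

(* Only x 0, .., x n matter; infinite sequences make every face a
   precomposition with some bump k. *)
Definition homog n (theta : cochains N n) x : N :=
  gact (x 0%N) (theta (steps n x)).

Lemma nth_steps n x i : (i < n)%N ->
  nth 1%g (steps n x) i = ((x i)^-1 * x i.+1)%g.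
Proof.
by move=> ltin; rewrite -[i]/(val (Ordinal ltin)) -tnth_nth tnth_mktuple.
Qed.

Lemma path_of_steps n x k : (k <= n)%N -> path_of (x 0%N) (steps n x) k = x k.
Proof.
elim: k => //= k IHk ltkn; rewrite IHk ?(ltnW ltkn) // nth_steps //.
by rewrite mulVKg.
Qed.

Lemma steps_path_of n y (g : n.-tuple G) : steps n (path_of y g) = g.
Proof.
by apply: eq_from_tnth => i; rewrite tnth_mktuple /= mulKg (tnth_nth 1%g).
Qed.

Lemma eq_steps n x x' :
  (forall i, (i <= n)%N -> x i = x' i) -> steps n x = steps n x'.
Proof.
move=> E; apply: eq_from_tnth => i; rewrite !tnth_mktuple.
by rewrite !E // ltnW.
Qed.

Lemma eq_homog n (theta : cochains N n) x x' :
  (forall i, (i <= n)%N -> x i = x' i) -> homog theta x = homog theta x'.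
Proof. by move=> E; rewrite /homog (eq_steps E) E. Qed.

Lemma homog_inj n (a b : cochains N n) : homog a =1 homog b -> a = b.
Proof.
move=> E; apply/funext => g.
by have := E (path_of 1%g g); rewrite /homog steps_path_of !gact1.
Qed.

(** Precomposing with [bump k] deletes [x k]. Deleting [x 0] moves the base point to [x 1], which
    absorbs the action of the first step; deleting an inner point multiplies the two adjacent
    steps. *)
Lemma homog_diff n (theta : cochains N n) x :
  homog (cochain_diff theta) x =
  \sum_(0 <= k < n.+2) homog theta (x \o bump k) *~ (-1) ^+ k.
Proof.
rewrite /homog /cochain_diff !gactD.
rewrite [RHS]big_nat_recr //= [in RHS]big_nat_recl //= expr0 mulr1z.
congr (_ + _ + _).
- rewrite -gactM [thead _](tnth_nth 1%g) nth_steps // mulVKg /bump /=.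
  congr (gact _ (theta _)); apply: eq_from_tnth => i.
  by rewrite (tnth_nth 1%g) nth_behead nth_steps ?ltnS // tnth_mktuple.
- rewrite big_add1 /= (raddf_sum (@gact G N (x 0%N))).
  apply: eq_big_nat => k /andP[_ ltkn].
  rewrite (raddfMz (@gact G N (x 0%N))) /bump /=.
  congr (gact _ (theta _) *~ _).
  apply: eq_from_tnth => i; have ltin : (i.+1 < n.+1)%N := ltn_ord i.
  rewrite !tnth_mktuple /= !nth_steps // ?(ltnW ltin) //.
  rewrite /bump !ltnS eqSS; case: ltngtP => // ->.
  by rewrite mulgA mulgK.
- rewrite (raddfMz (@gact G N (x 0%N))) /bump /=.
  congr (gact _ (theta _) *~ _).
  apply: eq_from_tnth => i; have ltin := ltn_ord i.
  rewrite !tnth_mktuple /= /bump.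
  by rewrite [(n < i)%N]ltnNge [(n < i.+1)%N]ltnNge ltin ltnW.
Qed.

End HomogeneousForm.

(** * Combinatorics of the prism decomposition *)

(** With signs included, [A i k] stands for face [k] of prism simplex [i], and [B i k] for simplex
    [i] of the prism over face [k]. The faces [k = i] and [k = i.+1], shared by neighbouring
    simplices, telescope; the others match [B]. *)
Lemma prism_sum (V : zmodType) m (A B : nat -> nat -> V) (E : nat -> V) :
    (forall i k, (k < i)%N -> A i k = - B i.-1 k) ->
    (forall i, A i i = E i) ->
    (forall i, A i i.+1 = - E i.+1) ->
    (forall i k, (i.+1 < k)%N -> A i k = - B i k.-1) ->
  \sum_(0 <= i < m.+1) \sum_(0 <= k < m.+2) A i k =
  E 0%N - E m.+1 - \sum_(0 <= i < m) \sum_(0 <= k < m.+1) B i k.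
Proof.
move=> Alt Adiag Asucc Agt.
have row i : (i < m.+1)%N -> \sum_(0 <= k < m.+2) A i k =
    (E i - E i.+1) -
    (\sum_(0 <= k < i) B i.-1 k + \sum_(i.+1 <= k < m.+1) B i k).
  move=> le_im.
  rewrite (big_cat_nat (n := i)) //=; last by lia.
  have -> : \sum_(0 <= k < i) A i k = - \sum_(0 <= k < i) B i.-1 k.
    by rewrite -sumrN; apply: eq_big_nat => k /andP[_ /Alt].
  rewrite [\sum_(i <= _ < _) _]big_ltn ?ltnS ?(ltnW le_im) //.
  rewrite [\sum_(i.+1 <= _ < _) _]big_ltn ?ltnS // Adiag Asucc big_add1 /=.
  have -> : \sum_(i.+1 <= k < m.+1) A i k.+1 = - \sum_(i.+1 <= k < m.+1) B i k.
    by rewrite -sumrN; apply: eq_big_nat => k /andP[ltik _]; rewrite Agt ?ltnS.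
  by rewrite opprD (addrA (E i)) addrCA.
under eq_big_nat => i /andP[_ /row ->] do [].
rewrite sumrB.
rewrite (telescope_sumr_eq (fun i => - E i)) // => [|i _]; last first.
  by rewrite opprK addrC.
rewrite opprK [- _ + _]addrC; congr (_ - _); rewrite big_split /=.
(* Row [i] of [B] gets its columns up to [i] from row [i.+1] of [A] and the later ones from row [i];
   the two unmatched end sums are empty. *)
rewrite big_nat_recl // [X in _ + X]big_nat_recr //= big_nil add0r.
rewrite [X in _ + (_ + X)]big_geq // addr0 -big_split /=.
by apply: eq_big_nat => i /andP[_ ltim]; rewrite -big_cat_nat //=; lia.
Qed.

(** * Cochains with coinduced coefficients as equivariant functions on sequences *)

Section CoinducedHomogeneousForm.
Variables (G : groupType) (P : pred G) (Q : subGroupType P) (M : gmodType Q).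
Implicit Types (x : nat -> G) (y : G).

Definition coind_eval y (f : coind M) : M := f y.

Fact coind_eval_is_additive y : zmod_morphism (coind_eval y).
Proof. by []. Qed.

HB.instance Definition _ y :=
  GRing.isZmodMorphism.Build (coind M) M (coind_eval y)
    (coind_eval_is_additive y).

(* The homogeneous form under Frobenius reciprocity
   Hom_G(-, Coind M) = Hom_Q(-, M). *)
Definition coind_homog n (theta : cochains (coind M) n) x : M :=
  theta (steps n x) (x 0%N).

Lemma coind_homogE n (theta : cochains (coind M) n) x :
  coind_homog theta x = coind_eval 1%g (homog theta x).
Proof. by rewrite /coind_eval /homog /= mul1g. Qed.

Lemma eq_coind_homog n (theta : cochains (coind M) n) x x' :
  (forall i, (i <= n)%N -> x i = x' i) ->
  coind_homog theta x = coind_homog theta x'.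
Proof. by move=> E; rewrite !coind_homogE (eq_homog _ E). Qed.

(** Starting the path at [y] realises evaluation at [y], so arbitrary starting points recover the
    whole coinduced value. *)
Lemma coind_homog_inj n (a b : cochains (coind M) n) :
  coind_homog a =1 coind_homog b -> a = b.
Proof.
move=> E; apply/funext => g; apply: coind_ext => y.
by have := E (path_of y g); rewrite /coind_homog steps_path_of.
Qed.

Lemma coind_homog_diff n (theta : cochains (coind M) n) x :
  coind_homog (cochain_diff theta) x =
  \sum_(0 <= k < n.+2) coind_homog theta (x \o bump k) *~ (-1) ^+ k.
Proof.
rewrite coind_homogE homog_diff raddf_sum; apply: eq_bigr => k _.
by rewrite raddfMz coind_homogE.
Qed.

(** Left translation leaves the steps unchanged, so [q] only reaches the evaluation point. *)
Lemma coind_homog_equivariant n (theta : cochains (coind M) n) (q : Q) x :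
  coind_homog theta (fun i => (val q * x i)%g) = gact q (coind_homog theta x).
Proof.
rewrite /coind_homog -coindE; congr (coind_fun (theta _) _).
by apply: eq_from_tnth => i; rewrite !tnth_mktuple invgM mulgA mulgVK.
Qed.

End CoinducedHomogeneousForm.

(** * The maps psi and phi in homogeneous coordinates *)

Section ShapiroMaps.
Variables (G : groupType) (P : pred G) (Q : subGroupType P) (T : {pred G}).
Hypothesis trT : right_transversal Q T.
Variable M : gmodType Q.
Implicit Types (x : nat -> G).

Lemma subgroup_partM (q : Q) (y : G) :
  subgroup_part trT (val q * y)%g = (q * subgroup_part trT y)%g.
Proof.
by rewrite [y in LHS](transversal_partP trT) mulgA -valM transversal_part_uniq.
Qed.

Lemma transversal_partM (q : Q) (y : G) :
  transversal_part trT (val q * y)%g = transversal_part trT y.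
Proof.
by rewrite [y in LHS](transversal_partP trT) mulgA -valM transversal_part_uniq.
Qed.

Lemma val_transversal_part (y : G) :
  val (transversal_part trT y) = (val (subgroup_part trT y)^-1 * y)%g.
Proof.
by apply: (mulgI (val (subgroup_part trT y)));
  rewrite -transversal_partP mulgA -valM mulgV val1 mul1g.
Qed.

(** If s_k = r(x_k)^-1 x_k, then multiplying by the step x_k^-1 x_(k+1) gives r(x_k)^-1 x_(k+1),
    which lies in the coset Q x_(k+1). *)
Lemma coset_walk_steps n x k : (k <= n)%N ->
  coset_walk trT (transversal_part trT (x 0%N)) (steps n x) k =
  transversal_part trT (x k).
Proof.
elim: k => //= k IHk ltkn; rewrite IHk ?(ltnW ltkn) // nth_steps //.
by rewrite val_transversal_part -mulgA mulVKg transversal_partM.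
Qed.

Lemma coset_steps_steps n x :
  coset_steps trT (transversal_part trT (x 0%N)) (steps n x) =
  steps n (subgroup_part trT \o x).
Proof.
apply: eq_from_tnth => i; have ltin := ltn_ord i.
rewrite !tnth_mktuple coset_walk_steps ?(ltnW ltin) //.
by rewrite val_transversal_part -mulgA mulVKg subgroup_partM.
Qed.

(** The factor r(x_0) by which [coind_extend] acts is exactly the leading action in [homog]. *)
Lemma coind_homog_psi n (mu : cochains M n) x :
  coind_homog (shapiro_psi trT mu) x = homog mu (subgroup_part trT \o x).
Proof. by rewrite /coind_homog /= coset_steps_steps. Qed.

(** Equivariance of the coinduced value turns the action of q_0 into evaluation at q_0. *)
Lemma homog_phi n (theta : cochains (coind M) n) (q : nat -> Q) :
  homog (shapiro_phi theta) q = coind_homog theta (val \o q).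
Proof.
rewrite /homog /shapiro_phi -coindE mulg1 /coind_homog.
congr (coind_fun (theta _) _); apply: eq_from_tnth => i.
by rewrite tnth_map !tnth_mktuple valM gmulfV.
Qed.

(** Deleting a coordinate commutes with applying r to every coordinate. *)
Lemma shapiro_psi_cochain_map :
  is_cochain_map (fun n => @shapiro_psi G P Q T trT M n :
    cochain_cplx M n -> cochain_cplx (coind M) n).
Proof.
split=> [n a b|n mu].
  apply: coind_homog_inj => x.
  have E (u v : cochains (coind M) n) :
    coind_homog (u - v) x = coind_homog u x - coind_homog v x by [].
  by rewrite E !coind_homog_psi /homog -gactB.
apply: coind_homog_inj => x; rewrite coind_homog_psi homog_diff.
rewrite [RHS]coind_homog_diff.
by apply: eq_bigr => k _; rewrite coind_homog_psi.
Qed.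

Lemma shapiro_phi_cochain_map :
  is_cochain_map (fun n => @shapiro_phi G P Q M n :
    cochain_cplx (coind M) n -> cochain_cplx M n).
Proof.
split=> [n a b|n theta]; first by [].
apply: homog_inj => q; rewrite homog_phi coind_homog_diff.
rewrite [RHS]homog_diff.
by apply: eq_bigr => k _; rewrite homog_phi.
Qed.

(** As 1 lies in [T], the decomposition of q in Q is q times 1, so r is the identity on Q. *)
Lemma shapiro_psiK (T1 : 1%g \in T) n :
  cancel (@shapiro_psi G P Q T trT M n) (@shapiro_phi G P Q M n).
Proof.
move=> mu; apply: homog_inj => q; rewrite homog_phi coind_homog_psi.
apply: eq_homog => i _ /=.
by rewrite -[val (q i)]mulg1 (transversal_part_uniq trT (q i) (exist _ 1%g T1)).
Qed.

(** * The prism homotopy *)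

(* The i-th simplex (r x_0, .., r x_i, x_i, x_(i+1), ..) of the prism between x
   and its retraction r x to Q. *)
Definition prism i x j : G :=
  if (j <= i)%N then val (subgroup_part trT (x j)) else x j.-1.

Lemma prismM i (q : Q) x j :
  prism i (fun l => val q * x l)%g j = (val q * prism i x j)%g.
Proof. by rewrite /prism subgroup_partM valM; case: ifP. Qed.

Fact prism_homotopy_subproof n (theta : cochains (coind M) n.+1)
    (g : n.-tuple G) :
  (fun y => \sum_(0 <= i < n.+1)
     coind_homog theta (prism i (path_of y g)) *~ (-1) ^+ i.+1)
    \in @equivariant G P Q M.
Proof.
apply/asboolP => q y; rewrite (raddf_sum (@gact Q M q)); apply: eq_bigr => i _.
rewrite (raddfMz (@gact Q M q)) /= -coind_homog_equivariant; congr (_ *~ _).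
apply: eq_coind_homog => j _; rewrite -prismM; congr (prism i _ j).
by apply/funext => l; elim: l => //= l ->; rewrite mulgA.
Qed.

(** The argument [g] supplies the steps of a path and the evaluation point its start. The sign
    [(-1) ^+ i.+1] makes ds + sd equal to psi phi - id rather than its opposite. *)
Definition prism_homotopy n (theta : cochains (coind M) n.+1) :
    cochains (coind M) n :=
  fun g => Coind (prism_homotopy_subproof theta g).

Lemma eq_prism n i x x' : (i <= n)%N -> (forall j, (j <= n)%N -> x j = x' j) ->
  forall j, (j <= n.+1)%N -> prism i x j = prism i x' j.
Proof.
move=> lein E j lejn; rewrite /prism; case: ifP => [leji|_].
  by rewrite E // (leq_trans leji).
by rewrite E //; lia.
Qed.

Lemma coind_homog_prism n (theta : cochains (coind M) n.+1) x :
  coind_homog (prism_homotopy theta) x =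
  \sum_(0 <= i < n.+1) coind_homog theta (prism i x) *~ (-1) ^+ i.+1.
Proof.
apply: eq_big_nat => i /andP[_ lein]; congr (_ *~ _).
by apply/eq_coind_homog/eq_prism => // j; apply: path_of_steps.
Qed.

Fact prism_homotopy_is_additive n : zmod_morphism (@prism_homotopy n).
Proof.
move=> a b; apply: coind_homog_inj => x.
have E m (u v : cochains (coind M) m) z :
  coind_homog (u - v) z = coind_homog u z - coind_homog v z by [].
rewrite E !coind_homog_prism -sumrB; apply: eq_bigr => i _.
by rewrite E mulrzBl.
Qed.

HB.instance Definition _ n :=
  GRing.isZmodMorphism.Build (cochains (coind M) n.+1) (cochains (coind M) n)
    (@prism_homotopy n) (@prism_homotopy_is_additive n).

(** The deleted entry is the retracted r(x_k), so the switch from retracted to original points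
    occurs one place earlier. *)
Lemma prism_bump_lt i k x : (k < i)%N ->
  prism i x \o bump k =1 prism i.-1 (x \o bump k).
Proof.
case: i => // i; rewrite ltnS => leki j; rewrite /prism /= /bump.
have [lekj|ltjk] := leqP k j; last first.
  have leji : (j <= i)%N by lia.
  by rewrite add0n leji leqW.
rewrite add1n ltnS; case: ifP => //= ltij.
have -> : (k <= j.-1)%N = true by lia.
by congr x; lia.
Qed.

(** Past the switch, entry [k] of the simplex is x_(k-1), hence the shift to [k.-1]. *)
Lemma prism_bump_gt i k x : (i.+1 < k)%N ->
  prism i x \o bump k =1 prism i (x \o bump k.-1).
Proof.
case: k => // k; rewrite ltnS => ltik j; rewrite /prism /= /bump /=.
have [leji|ltij] := leqP j i.
  have ltjk : (j < k)%N by lia.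
  by rewrite [(k < j)%N]ltnNge (ltnW ltjk) [(k <= j)%N]leqNgt ltjk add0n leji.
rewrite leqNgt (leq_trans ltij (leq_addl _ _)) /=.
by congr x; lia.
Qed.

(** The homotopy identity in coordinates: the left side is s d, and the double sum is d s (empty in
    degree 0). *)
Lemma prism_homotopyP n (theta : cochains (coind M) n) x :
  \sum_(0 <= i < n.+1) coind_homog (cochain_diff theta) (prism i x)
     *~ (-1) ^+ i.+1 =
  coind_homog (shapiro_psi trT (shapiro_phi theta)) x - coind_homog theta x -
  \sum_(0 <= i < n) \sum_(0 <= k < n.+1)
     coind_homog theta (prism i (x \o bump k)) *~ (-1) ^+ i.+1 *~ (-1) ^+ k.
Proof.
pose A i k := coind_homog theta (prism i x \o bump k)
  *~ (-1) ^+ k *~ (-1) ^+ i.+1.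
pose B i k := coind_homog theta (prism i (x \o bump k))
  *~ (-1) ^+ i.+1 *~ (-1) ^+ k.
(* The face common to simplices [i.-1] and [i], negated because face [i] of simplex [i] has odd sign
   exponent. At [i = 0] it is [x]; at [i = n.+1] all the coordinates that matter are retracted. *)
pose E i := - coind_homog theta
  (fun j => if (j < i)%N then val (subgroup_part trT (x j)) else x j).
transitivity (\sum_(0 <= i < n.+1) \sum_(0 <= k < n.+2) A i k).
  by apply: eq_bigr => i _; rewrite coind_homog_diff mulrz_suml.
rewrite (@prism_sum _ n A B E).
- congr (_ - _); rewrite /E opprK addrC coind_homog_psi homog_phi.
  by congr (_ - _); apply: eq_coind_homog => j lejn /=; rewrite ltnS lejn.
- move=> i k ltki; rewrite /A /B.
  rewrite (eq_coind_homog _ (fun j _ => prism_bump_lt x ltki j)).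
  case: i ltki => // i _ /=.
  by rewrite -!mulrzA mulrC [in LHS]exprS mulN1r mulNr mulrNz.
- move=> i; rewrite /A /E -mulrzA -exprD addnS -signr_odd /= oddD addbb /=.
  rewrite mulrN1z.
  congr (- _); apply: eq_coind_homog => j _; rewrite /prism /= /bump.
  case: leqP => [leij|ltji]; first by rewrite add1n ltnNge leij.
  by rewrite add0n ltnW.
- move=> i; rewrite /A /E -mulrzA -exprD -signr_odd oddD addbb /= mulr1z opprK.
  apply: eq_coind_homog => j _; rewrite /prism /= /bump ltnS.
  have [leji|ltij] := leqP j i; first by rewrite add0n leji.
  by rewrite add1n ltnNge (ltnW ltij).
- move=> i k ltik; rewrite /A /B.
  rewrite (eq_coind_homog _ (fun j _ => prism_bump_gt x ltik j)).
  case: k ltik => // k _ /=.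
  by rewrite -!mulrzA mulrC (exprS _ k) mulN1r mulrN mulrNz.
Qed.

Lemma shapiro_phiK_homotopic :
  cochain_homotopic
    (fun n => (shapiro_psi trT (n := n) \o @shapiro_phi G P Q M n) :
       cochain_cplx (coind M) n -> cochain_cplx (coind M) n)
    (fun n => @idfun (cochain_cplx (coind M) n)).
Proof.
exists (fun n => @prism_homotopy n); split=> [theta|n theta].
  apply: coind_homog_inj => x.
  by rewrite coind_homog_prism prism_homotopyP
    [\sum_(0 <= _ < 0) _]big_geq // subr0.
apply: coind_homog_inj => x.
have E m (u v : cochains (coind M) m) z :
  coind_homog (u + v) z = coind_homog u z + coind_homog v z by [].
rewrite [RHS]E coind_homog_prism prism_homotopyP coind_homog_diff /=.
under [X in _ = X + _]eq_bigr do rewrite coind_homog_prism mulrz_suml.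
(* Swapping the sums over faces and prism simplices makes the d s term cancel the double sum. *)
by rewrite [in RHS]exchange_big_nat /= [RHS]addrC subrK.
Qed.

End ShapiroMaps.

(** * The two maps as mutually inverse homotopy equivalences *)

Theorem theorem6p1 (G : groupType) (P : pred G) (Q : subGroupType P)
    (M : gmodType Q) (T : {pred G})
    (trT : right_transversal Q T) (T1 : (1%g : G) \in T) :
  homotopy_equivalence
    (fun n => @shapiro_psi G P Q T trT M n :
       cochain_cplx M n -> cochain_cplx (coind M) n) /\
  homotopy_equivalence
    (fun n => @shapiro_phi G P Q M n :
       cochain_cplx (coind M) n -> cochain_cplx M n).
Proof.
have psi_map := shapiro_psi_cochain_map trT M.
have phi_map := shapiro_phi_cochain_map M.
have phi_psi : cochain_homotopic
    (fun n => (@shapiro_phi G P Q M n \o shapiro_psi trT (n := n)) :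
       cochain_cplx M n -> cochain_cplx M n)
    (fun n => @idfun (cochain_cplx M n)).
  have E n (mu : cochains M n) : shapiro_phi (shapiro_psi trT mu) - mu = 0.
    by rewrite (shapiro_psiK trT T1) subrr.
  (* Since phi psi equals the identity exactly, the zero homotopy suffices. *)
  exists (fun n => \0); split=> [mu|n mu]; first exact: E.
  by apply: (etrans (E _ mu)); rewrite addr0 raddf0.
split; split=> //.
- exists (fun n => @shapiro_phi G P Q M n); split=> //.
  exact: shapiro_phiK_homotopic.
- exists (fun n => @shapiro_psi G P Q T trT M n); split=> //.
  exact: shapiro_phiK_homotopic.
Qed.
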